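(* Let $n\ge 1$, let $a_0,a_1,\ldots,a_n$ be nonnegative integers, put $a=a_1+\cdots+a_n$, and let $r$ be a fixed integer with $0<r\le n$. Then $$\mathop{\mathrm{CT}}_{\mathbf{x}}\frac{x_r}{x_0}\,D_n(\mathbf{x},\mathbf{a},q)=-q^{\sum_{k=1}^{r-1}a_k}\left(\frac{1-q^{a_0}}{1-q^{a+1}}\right)\frac{(q)_{a+a_0}}{(q)_{a_0}(q)_{a_1}\cdots(q)_{a_n}}.$$
   Context: Here $q$ is an indeterminate, $\mathbf{x}=(x_0,\ldots,x_n)$, $\mathbf{a}=(a_0,\ldots,a_n)$, and $(z)_k=(1-z)(1-zq)\cdots(1-zq^{k-1})$ for integers $k\ge 0$. The $q$-Dyson product is $$D_n(\mathbf{x},\mathbf{a},q)=\prod_{0\le i<j\le n}\left(\frac{x_i}{x_j}\right)_{a_i}\left(\frac{x_j}{x_i}q\right)_{a_j}.$$ $\mathop{\mathrm{CT}}_{\mathbf{x}}F(\mathbf{x})$ denotes the constant term of $F$ in the variables $x_0,\ldots,x_n$. Note that $a$ does not include $a_0$. *)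

(* Defs.v *)
From HB Require Import structures.
From mathcomp Require Import all_boot all_order all_algebra.
From mathcomp Require Import finmap mpoly.

Set Implicit Arguments.
Unset Strict Implicit.
Unset Printing Implicit Defensive.

Import Order.TTheory GRing.Theory Num.Theory.
Local Open Scope ring_scope.

(* The field F(x_0, ..., x_{n-1}) of rational functions over F; the Laurent   *)
(* polynomials are those of its elements that are finite F-linear             *)
(* combinations of the monomials x^e, with e an integer exponent vector.      *)
Notation ratfun F n := {fraction {mpoly F[n]}}.

Section LaurentPolynomials.

Variables (F : fieldType) (n : nat).

Definition rf_const (c : F) : ratfun F n := tofrac (c%:MP).

Definition rf_var (i : 'I_n) : ratfun F n := tofrac ('X_i).

Definition laurent_monomial (e : {ffun 'I_n -> int}) : ratfun F n :=
  \prod_(i < n) rf_var i ^ e i.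

Definition laurent_sum (L : {fsfun {ffun 'I_n -> int} -> F with 0}) :
    ratfun F n :=
  \sum_(e <- finsupp L) rf_const (L e) * laurent_monomial e.

(* The rational function f is a Laurent polynomial with constant term c; by   *)
(* is_CT_uniq below, c is determined by f.                                    *)
Definition is_CT (f : ratfun F n) (c : F) : Prop :=
  exists2 L, f = laurent_sum L & c = L [ffun=> 0].

Lemma rf_var_neq0 i : rf_var i != 0.
Proof.
rewrite tofrac_eq0; apply/eqP => /(congr1 (mcoeff U_(i))).
by rewrite mcoeffXU eqxx mcoeff0 => /eqP; rewrite oner_eq0.
Qed.

Let shift (N : nat) (e : {ffun 'I_n -> int}) : 'X_{1..n} :=
  [multinom `|(e i + N%:Z)%R|%N | i < n].

Let shifted_poly N (L : {fsfun {ffun 'I_n -> int} -> F with 0}) : {mpoly F[n]} :=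
  \sum_(e <- finsupp L) (L e)%:MP * 'X_[shift N e].

Let laurent_sum_shift N (L : {fsfun {ffun 'I_n -> int} -> F with 0}) :
  (forall e, e \in finsupp L -> forall i, 0 <= e i + N%:Z) ->
  laurent_sum L * \prod_(i < n) rf_var i ^+ N = tofrac (shifted_poly N L).
Proof.
move=> hN; rewrite /laurent_sum mulr_suml rmorph_sum /=.
rewrite big_seq [RHS]big_seq; apply: eq_bigr => e he.
rewrite rmorphM /= -mulrA; congr (_ * _).
rewrite mpolyXE_id rmorph_prod /= -big_split /=; apply: eq_bigr => i _.
by rewrite rmorphXn mnmE !exprnP gez0_abs ?hN // expfzDr ?rf_var_neq0.
Qed.

Let shifted_poly_coef N (L : {fsfun {ffun 'I_n -> int} -> F with 0}) :
  (forall e, e \in finsupp L -> forall i, 0 <= e i + N%:Z) ->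
  (shifted_poly N L)@_(shift N [ffun=> 0]) = L [ffun=> 0].
Proof.
move=> hN; rewrite raddf_sum /=.
have E e : e \in finsupp L ->
    (shift N e == shift N [ffun=> 0]) = (e == [ffun=> 0]).
  move=> he; apply/eqP/eqP => [/mnmP h | -> //]; apply/ffunP => i.
  have := h i; rewrite !mnmE !ffunE add0r absz_nat => hi.
  by apply: (addIr N%:Z); rewrite add0r -[LHS]gez0_abs ?hN // hi.
rewrite big_seq (eq_bigr (fun e => L e * (e == [ffun=> 0])%:R)); last first.
  by move=> e he; rewrite mcoeffCM mcoeffX E.
rewrite -big_seq; have [h0|h0] := boolP ([ffun=> 0] \in finsupp L).
  rewrite (big_fsetD1 _ h0) /= eqxx mulr1 big_seq big1 ?addr0 // => e.
  by rewrite in_fsetD1 => /andP[/negPf-> _]; rewrite mulr0.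
rewrite (fsfun_dflt h0) big_seq big1 // => e he.
case: eqP => [e0|_]; last by rewrite mulr0.
by rewrite -e0 he in h0.
Qed.

Let shift_bound (L : {fsfun {ffun 'I_n -> int} -> F with 0}) :
  {N0 : nat | forall N, (N0 <= N)%N ->
    forall e, e \in finsupp L -> forall i, 0 <= e i + N%:Z}.
Proof.
exists (\sum_(e <- finsupp L) \sum_(i < n) `|e i|)%N => N hN e he i.
rewrite -lerBlDr sub0r (le_trans (_ : _ <= - `|e i|%N%:Z)) //; last first.
  by rewrite abszE lerNl -normrN ler_norm.
rewrite lerN2 lez_nat (leq_trans _ hN) // (big_fsetD1 _ he) /= (bigD1 i) //=.
by rewrite -addnA leq_addr.
Qed.

Lemma is_CT_uniq (f : ratfun F n) (c c' : F) : is_CT f c -> is_CT f c' -> c = c'.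
Proof.
move=> [L fL ->] [L' fL' ->].
have [N hN] := shift_bound L; have [N' hN'] := shift_bound L'.
have h := hN _ (leq_maxl N N'); have h' := hN' _ (leq_maxr N N').
rewrite -(shifted_poly_coef h) -(shifted_poly_coef h'); congr (_@__).
by apply/eqP; rewrite -tofrac_eq -!laurent_sum_shift // -fL fL'.
Qed.

End LaurentPolynomials.

Definition qpoch (R : nzRingType) (q z : R) (k : nat) : R :=
  \prod_(i < k) (1 - z * q ^+ i).

Definition qDyson (F : fieldType) (q : F) (n : nat) (a : 'I_n.+1 -> nat) :
    ratfun F n.+1 :=
  let x := @rf_var F n.+1 in
  let Q := rf_const n.+1 q in
  \prod_(i < n.+1) \prod_(j < n.+1 | (i < j)%N)
    (qpoch Q (x i / x j) (a i) * qpoch Q (x j / x i * Q) (a j)).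

(* The indeterminate q, as an element of the field K(q). *)
Definition qvar (K : fieldType) : {fraction {poly K}} := tofrac 'X.

(* Main.v *)
Require Import Defs.
From mathcomp Require Import all_boot all_order all_algebra.
From mathcomp Require Import finmap mpoly.
From mathcomp Require Import zify ring.

(** The constant term is read off as one coefficient of a polynomial, and that
coefficient is evaluated by sampling the polynomial on a grid where it has at
most one nonzero value (the method of Karolyi and Nagy for the q-Dyson theorem).

Write sigma for the sum of all the a_k and a for the sum without a_0.  Clearing
denominators, the q-Dyson product is D divided by the product of the
x_i^(sigma - a_i), where D is the homogeneous product of the factors
x_i - q^(t + [i < j]) x_j over all i <> j and t < a_j ([qDysonE]).  The constant
term sought is thus the coefficient of x^d in x_r D, where d_i = sigma - a_i for
i > 0 and d_0 = a + 1 ([is_CT_ratio_qDyson]).  This coefficient is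
of top degree, so x_r may be replaced by x_r - c for any constant c
([mcoeff_shift_top]).

A coefficient of x^d in a polynomial P of degree at most |d| is a weighted sum
of the values of P on any grid with d_i + 1 nodes in direction i, because
one-variable Lagrange interpolation recovers leading coefficients
([mcoeff_grid]).  The nodes chosen are 1, q, ..., q^(d_i).  At a point
(q^(alpha_i)) where D does not vanish, the integer intervals
[alpha_i, alpha_i + a_i) are disjoint, and the following one leaves a gap
whenever its index is smaller.  The bounds alpha_i <= d_i leave so little room
that only two arrangements survive: the blocks in the order 0, 1, ..., n,
without gaps, or in the order 1, ..., n, 0, with a gap of one before block 0
([separated_eq_survivor]).  The first is killed by choosing
c = q^(a_0 + ... + a_(r-1)), the value that x_r takes there.

At the second point alpha_r = a_1 + ... + a_(r-1), so the factor x_r - c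
contributes q^(alpha_r) (1 - q^(a_0)).  In direction 0, the node weight has one
factor more than D, which leaves -1/(1 - q^(a+1)) ([dyson_ratio0]).  In
direction i > 0 the quotient is a ratio of q-factorials that telescopes to the
q-multinomial coefficient ([dyson_ratio_pos]). *)

Set Implicit Arguments.
Unset Strict Implicit.
Unset Printing Implicit Defensive.

Import GRing.Theory.
Local Open Scope ring_scope.

(** * Coefficients from values on a grid *)

(** For j <= d, the derivative at [z j] of the monic polynomial with roots
z_0, ..., z_d. *)
Definition node_weight (F : fieldType) (z : nat -> F) (d j : nat) : F :=
  \prod_(k < d.+1 | k != j :> nat) (z j - z k).

Lemma node_weight_neq0 (F : fieldType) (z : nat -> F) d j :
  injective z -> node_weight z d j != 0.
Proof.
move=> zI; apply/prodf_neq0 => k kj; rewrite subr_eq0 eq_sym.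
by apply: contraNneq kj => /zI ->.
Qed.

(** The sum is the coefficient of X^d in the Lagrange interpolant of X^m at
z_0, ..., z_d, which is X^m itself since m <= d. *)
Lemma sum_node_weight (F : fieldType) (z : nat -> F) (d m : nat) :
  injective z -> (m <= d)%N ->
  \sum_(j < d.+1) z j ^+ m / node_weight z d j = (m == d)%:R.
Proof.
move=> zI le_md.
pose W (j : 'I_d.+1) := \prod_(k < d.+1 | k != j :> nat) ('X - (z k)%:P).
have Wmonic j : W j \is monic by apply: monic_prod => k _; apply: monicXsubC.
have sizeW j : size (W j) = d.+1.
  have := size_prod_XsubC (enum 'I_d.+1) (z \o val).
  rewrite big_enum (bigD1 j) //= size_mul ?polyXsubC_eq0 ?(monic_neq0 (Wmonic j)) //.
  by rewrite size_XsubC size_enum_ord => -[].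
pose p := \sum_(j < d.+1) (z j ^+ m / node_weight z d j) *: W j.
suff /(congr1 (fun P : {poly F} => P`_d)) : 'X^m - p = 0.
  rewrite coefB coefXn coef0 (eq_sym d) => /subr0_eq ->.
  rewrite coef_sum; apply: eq_bigr => j _; rewrite coefZ.
  by have := monicP (Wmonic j); rewrite lead_coefE sizeW => ->; rewrite mulr1.
apply: (@roots_geq_poly_eq0 _ _ [seq z (val j) | j <- enum 'I_d.+1]).
- apply/allP => _ /mapP [i _ ->]; rewrite rootE hornerD hornerN hornerXn.
  rewrite horner_sum (bigD1 i) //= big1 => [|j ji]; last first.
    rewrite hornerZ horner_prod (bigD1 i) 1?eq_sym //= hornerXsubC.
    by rewrite subrr mul0r mulr0.
  rewrite hornerZ horner_prod (eq_bigr _ (fun k _ => hornerXsubC _ _)).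
  by rewrite addr0 divfK ?node_weight_neq0 ?subrr.
- by rewrite map_inj_uniq ?enum_uniq // => i j /zI /val_inj.
rewrite size_map size_enum_ord (leq_trans (size_polyD _ _)) // geq_max.
rewrite size_polyXn ltnS le_md size_polyN (leq_trans (size_sum _ _ _)) //.
by apply/bigmax_leqP => j _; rewrite (leq_trans (size_scale_leq _ _)) ?sizeW.
Qed.

(** The quantitative form of the combinatorial Nullstellensatz: the product of
the functionals of [sum_node_weight] sends x^d to 1 and every other monomial of
degree at most |d| to 0. *)
Lemma mcoeff_grid (F : fieldType) (n : nat) (z : nat -> F) (d : 'X_{1..n})
    (P : {mpoly F[n]}) :
  injective z -> (msize P <= (mdeg d).+1)%N ->
  P@_d = \sum_(f in family (fun i => [pred j : 'I_(mdeg d).+1 | j < (d i).+1]%N))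
            P.@[fun i => z (f i)] / \prod_(i < n) node_weight z (d i) (f i).
Proof.
move=> zI sizeP.
have leN i : ((d i).+1 <= (mdeg d).+1)%N.
  by rewrite ltnS mdegE (bigD1 i) //= leq_addr.
pose Lam (m : 'X_{1..n}) :=
  \prod_(i < n) \sum_(j < (d i).+1) z j ^+ m i / node_weight z (d i) j.
transitivity (\sum_(m <- msupp P) P@_m * Lam m).
  have Lam_d : Lam d = 1.
    by apply: big1 => i _; rewrite sum_node_weight ?eqxx.
  (* Among the monomials of degree at most |d|, each m other than d has some
     m_i < d_i, and the i-th factor of its weight vanishes. *)
  have Lam0 m : m \in msupp P -> m != d -> Lam m = 0.
    move=> /msize_mdeg_lt mP m_d; apply/eqP/prodf_eq0.
    suff [i mi] : exists i, (m i < d i)%N.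
      by exists i => //; rewrite sum_node_weight ?(ltnW mi) ?ltn_eqF.
    apply/existsP; apply: contraNT m_d; rewrite negb_exists => /forallP dm.
    have le_dm i : (d i <= m i)%N by rewrite leqNgt; apply: dm.
    have: (mdeg m <= mdeg d)%N by rewrite -ltnS (leq_trans mP).
    rewrite !mdegE => le_md.
    have := leqif_sum (fun i (_ : true) => leqif_eq (le_dm i)).
    case=> _; rewrite eqn_leq le_md leq_sum // => /esym/forallP E.
    by apply/eqP/mnmP => i; rewrite (eqP (E i)).
  have [dP|dP] := boolP (d \in msupp P).
    rewrite (bigD1_seq d) //= Lam_d mulr1 big_seq_cond big1 ?addr0 //.
    by move=> m /andP[mP md]; rewrite Lam0 ?mulr0.
  rewrite (memN_msupp_eq0 dP) big_seq big1 // => m mP.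
  by rewrite Lam0 ?mulr0 //; apply: contraNneq dP => <-.
transitivity (\sum_(m <- msupp P) P@_m *
  \sum_(f in family (fun i => [pred j : 'I_(mdeg d).+1 | j < (d i).+1]%N))
    \prod_(i < n) (z (f i) ^+ m i / node_weight z (d i) (f i))).
  apply: eq_bigr => m _; congr (_ * _).
  rewrite -(bigA_distr_big_dep (fun i => [pred j : 'I_(mdeg d).+1 | j < (d i).+1]%N)
    (fun i j => z (val j) ^+ m i / node_weight z (d i) (val j))).
  apply: eq_bigr => i _.
  exact: (big_ord_widen _ (fun j => z j ^+ m i / node_weight z (d i) j)).
under eq_bigr do rewrite mulr_sumr.
rewrite exchange_big; apply: eq_bigr => f _ /=.
rewrite mevalE mulr_suml; apply: eq_bigr => m _.
by rewrite -mulrA prodf_div.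
Qed.

Lemma mcoeff_grid1 (F : fieldType) (n : nat) (z : nat -> F) (d : 'X_{1..n})
    (P : {mpoly F[n]}) (g : 'I_n -> nat) :
  injective z -> (msize P <= (mdeg d).+1)%N ->
  (forall i, g i <= d i)%N ->
  (forall f : 'I_n -> nat, (forall i, f i <= d i)%N ->
     P.@[fun i => z (f i)] != 0 -> f =1 g) ->
  P@_d = P.@[fun i => z (g i)] / \prod_(i < n) node_weight z (d i) (g i).
Proof.
move=> zI sizeP gd gP; rewrite (mcoeff_grid zI sizeP).
have gN i : (g i < (mdeg d).+1)%N.
  by rewrite ltnS (leq_trans (gd i)) // mdegE (bigD1 i) //= leq_addr.
pose g0 := [ffun i => Ordinal (gN i)].
rewrite (bigD1 g0) /=; last by apply/familyP => i; rewrite ffunE inE /= ltnS.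
rewrite [X in _ + X]big1 => [|f /andP[/familyP fd f_g0]]; last first.
  have le_fd i : (f i <= d i)%N by have := fd i; rewrite inE ltnS.
  rewrite (_ : P.@[_] = 0) ?mul0r //; apply: contraNeq f_g0 => /(gP _ le_fd) fg.
  by apply/eqP/ffunP => i; apply: val_inj; rewrite ffunE /= -fg.
rewrite addr0; congr (_ / _).
  by apply: meval_eq => i; rewrite ffunE.
by apply: eq_bigr => i _; rewrite ffunE.
Qed.

(** * The q-Dyson product as a polynomial *)

(** The Laurent expansion of P / x^d is that of P with exponents shifted by d,
so that its constant term comes from the monomial x^d. *)
Lemma is_CT_mcoeff (F : fieldType) (n : nat) (P : {mpoly F[n]}) (d : 'X_{1..n}) :
  is_CT (tofrac P / tofrac 'X_[d]) P@_d.
Proof.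
pose e_of (m : 'X_{1..n}) : {ffun 'I_n -> int} := [ffun i => (m i)%:Z - (d i)%:Z].
have e_inj : injective e_of.
  move=> m m' /ffunP E; apply/mnmP => i.
  by have := E i; rewrite !ffunE => /addIr [].
pose m_of (e : {ffun 'I_n -> int}) : 'X_{1..n} :=
  [multinom `|(e i + d i)%R|%N | i < n].
have e_ofK m : m_of (e_of m) = m.
  by apply/mnmP => i; rewrite mnmE ffunE subrK absz_nat.
pose S := seq_fset tt [seq e_of m | m <- msupp P].
pose L : {fsfun {ffun 'I_n -> int} -> F with 0} := [fsfun e in S => P@_(m_of e)].
exists L.
  rewrite /laurent_sum (perm_big [seq e_of m | m <- msupp P]) /=; last first.
    apply: uniq_perm; first exact: fset_uniq.
      by rewrite (map_inj_uniq e_inj) msupp_uniq.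
    move=> e; rewrite mem_finsupp fsfunE seq_fsetE.
    case: mapP => [[m mP ->]|_]; last by rewrite eqxx.
    by rewrite e_ofK -mcoeff_msupp mP.
  rewrite big_map {1}[P]mpolyE rmorph_sum mulr_suml big_seq [RHS]big_seq /=.
  apply: eq_bigr => m mP; rewrite fsfunE seq_fsetE map_f // e_ofK.
  rewrite -mul_mpolyC rmorphM -mulrA; congr (_ * _).
  rewrite !mpolyXE_id !rmorph_prod -prodf_div /=; apply: eq_bigr => i _.
  by rewrite ffunE expfzDr ?rf_var_neq0 // !rmorphXn /= exprnP exprnN.
rewrite fsfunE seq_fsetE.
have -> : [ffun=> 0] = e_of d by apply/ffunP => i; rewrite !ffunE subrr.
rewrite e_ofK mem_map //.
by case: ifP => // /negbT /memN_msupp_eq0.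
Qed.

(** Each unordered pair contributes one term for each of its orientations. *)
Lemma big_pairs_neq (R : Type) (idx : R) (op : Monoid.com_law idx) n
    (f : 'I_n -> 'I_n -> R) :
  \big[op/idx]_(i < n) \big[op/idx]_(j < n | (i < j)%N) op (f j i) (f i j)
    = \big[op/idx]_(i < n) \big[op/idx]_(j < n | j != i) f i j.
Proof.
under eq_bigr do rewrite big_split.
rewrite big_split /= (exchange_big_dep xpredT) //= -big_split /=.
apply: eq_bigr => i _; rewrite [RHS](bigID (fun j : 'I_n => (j < i)%N)) /=.
congr (op _ _); apply: eq_bigl => j; rewrite -val_eqE /=; by case: ltngtP.
Qed.

(** The boolean exponent accounts for the asymmetry of the q-Dyson product: only
the second factor of each pair i < j carries an additional q. *)
Definition dyson_poly (F : fieldType) (q : F) n (a : 'I_n -> nat) : {mpoly F[n]} :=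
  \prod_(i < n) \prod_(j < n | j != i) \prod_(t < a j)
    ('X_i - q ^+ (t + (i < j)) *: 'X_j).

Definition dyson_expo n (a : 'I_n -> nat) : 'X_{1..n} :=
  [multinom (\sum_(j < n | j != i) a j)%N | i < n].

Lemma qDysonE (F : fieldType) (q : F) n (a : 'I_n.+1 -> nat) :
  qDyson q a = tofrac (dyson_poly q a) / tofrac 'X_[dyson_expo a].
Proof.
pose x := @rf_var F n.+1.
have qpochE i j :
    qpoch (rf_const n.+1 q) (x j / x i * rf_const n.+1 q ^+ (i < j)%N) (a j)
    = tofrac (\prod_(t < a j) ('X_i - q ^+ (t + (i < j)) *: 'X_j)) / x i ^+ a j.
  have -> : x i ^+ a j = \prod_(t < a j) x i by rewrite prodr_const card_ord.
  rewrite /qpoch rmorph_prod -prodf_div.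
  apply: eq_bigr => t _; rewrite rmorphB -mul_mpolyC rmorphM /= !rmorphXn /=.
  rewrite mulrBl divff ?rf_var_neq0 // -[tofrac 'X_j]/(x j).
  by rewrite exprD -[tofrac q%:MP]/(rf_const _ q); congr (1 - _); ring.
rewrite /qDyson.
transitivity (\prod_(i < n.+1) \prod_(j < n.+1 | j != i)
   (tofrac (\prod_(t < a j) ('X_i - q ^+ (t + (i < j)) *: 'X_j)) / x i ^+ a j)).
  rewrite -big_pairs_neq; apply: eq_bigr => i _; apply: eq_bigr => j ij.
  by rewrite -!qpochE ij ltnNge (ltnW ij) expr0 expr1 mulr1.
rewrite mpolyXE_id !rmorph_prod -prodf_div; apply: eq_bigr => i _ /=.
rewrite prodf_div rmorph_prod; congr (_ / _).
by rewrite mnmE expr_sum rmorph_prod; apply: eq_bigr => j _; rewrite rmorphXn.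
Qed.

Lemma dhomog_bigprod (F : fieldType) n (I : Type) (s : seq I) (A : pred I)
    (e : I -> nat) (p : I -> {mpoly F[n]}) :
  (forall i, A i -> p i \is (e i).-homog) ->
  \prod_(i <- s | A i) p i \is (\sum_(i <- s | A i) e i)%N.-homog.
Proof.
move=> hp; elim/big_rec2: _ => [|i d P Ai hP]; first exact: dhomog1.
by apply: dhomogM => //; apply: hp.
Qed.

Lemma dyson_homog (F : fieldType) (q : F) n (a : 'I_n -> nat) :
  dyson_poly q a \is (mdeg (dyson_expo a)).-homog.
Proof.
rewrite mdegE; apply: dhomog_bigprod => i _; rewrite mnmE.
apply: dhomog_bigprod => j _.
rewrite -[X in X.-homog]card_ord -sum1_card; apply: dhomog_bigprod => t _.
by apply: rpredB; last apply: rpredZ; rewrite dhomogX /= mdeg1.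
Qed.

Lemma is_CT_ratio_qDyson (F : fieldType) (q : F) n (a : 'I_n.+1 -> nat)
    (r s : 'I_n.+1) :
  is_CT (rf_var F r / rf_var F s * qDyson q a)
    ('X_r * dyson_poly q a)@_(dyson_expo a + U_(s)).
Proof.
rewrite qDysonE mulf_div -[rf_var F r * _]rmorphM [rf_var F s * _]mulrC.
rewrite -[_ * rf_var F s]rmorphM -mpolyXD.
exact: is_CT_mcoeff.
Qed.

Lemma msize_dhomog (F : fieldType) n d (p : {mpoly F[n]}) :
  p \is d.-homog -> (msize p <= d.+1)%N.
Proof.
move=> /dhomogP hp; rewrite msizeE big_seq; apply/bigmax_leqP_seq => m mp _.
by rewrite hp.
Qed.

(** For a homogeneous p, the constant c only changes terms below the top degree;
it is a free parameter, with which one grid point can be made a zero. *)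
Lemma mcoeff_shift_top (F : fieldType) n d (m : 'X_{1..n}) (p : {mpoly F[n]})
   (r : 'I_n) (c : F) :
  p \is d.-homog -> mdeg m = d.+1 ->
  (('X_r - c%:MP) * p)@_m = ('X_r * p)@_m /\
  (msize (('X_r - c%:MP) * p) <= (mdeg m).+1)%N.
Proof.
move=> hp dm.
have hXp : 'X_r * p \is d.+1.-homog.
  by rewrite -add1n; apply: dhomogM; rewrite // dhomogX /= mdeg1.
rewrite mulrBl mul_mpolyC; split.
  rewrite mcoeffB mcoeffZ (dhomog_nemf_coeff hp) ?mulr0 ?subr0 //=.
  by rewrite dm eqn_leq ltnn.
rewrite (leq_trans (msizeD_le _ _)) // geq_max msizeN dm.
rewrite (msize_dhomog hXp) (leq_trans (msizeZ_le _ _)) //.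
exact/ltnW/msize_dhomog.
Qed.

(** * Disjoint blocks of integers *)

(** The condition on exponents for the Dyson polynomial not to vanish at the point
with coordinates q^(alpha_i). *)
Definition separated n (a alpha : 'I_n -> nat) : Prop :=
  forall i j t, i != j -> (t < a j)%N -> alpha i <> (alpha j + t + (i < j))%N.

(** If the blocks are ordered by starting point, ties being broken by index, then
each block ends before the next one starts, strictly so if the index decreases.
The last block therefore starts at least as far as the total length of the
others; if it starts exactly there, then no gap and no descent of indices
occurred.  Removing the last block gives the induction. *)
Lemma separated_last n (a alpha : 'I_n -> nat) (S : {set 'I_n}) :
  separated a alpha -> S != set0 ->
  exists2 y, y \in S &
    [/\ forall i, i \in S -> i != y -> (alpha i + a i + (y < i) <= alpha y)%N,
        (\sum_(j in S | j != y) a j <= alpha y)%N &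
        (alpha y <= \sum_(j in S | j != y) a j)%N ->
        forall i, i \in S ->
          alpha i = (\sum_(j in S | (j < i)%N) a j)%N /\ (i <= y)%N].
Proof.
move=> sep; have [m] := ubnP #|S|; elim: m S => // m IHm S.
rewrite ltnS => leSm /set0Pn [x xS].
(* The key encodes the lexicographic order on (alpha i, i). *)
pose key (i : 'I_n) := (alpha i * n + i)%N.
have [y yS ymax] : exists2 y, y \in S & forall i, i \in S -> (key i <= key y)%N.
  by case: (@arg_maxnP _ x (mem S) key xS) => y yS ymax; exists y.
have gap i : i \in S -> i != y -> (alpha i + a i + (y < i) <= alpha y)%N.
  move=> iS iy; have := ymax i iS; rewrite /key => le_key.
  have ne_iy : i <> y :> nat by move/val_inj/eqP; apply/negP.
  have ltin := ltn_ord i; have ltyn := ltn_ord y.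
  rewrite leqNgt; apply/negP => lt_y.
  have le_iy : (alpha i + (y < i) <= alpha y)%N by case: ltnP => ?; nia.
  apply: (sep y i (alpha y - (alpha i + (y < i)))%N); first by rewrite eq_sym.
    by lia.
  by lia.
exists y => //.
have sumS (i0 : 'I_n) : (\sum_(j in S | j != i0) a j = \sum_(j in S :\ i0) a j)%N.
  by apply: eq_bigl => j; rewrite in_setD1 andbC.
have [Sy|Sy] := eqVneq (S :\ y) set0.
  have S1 : S = [set y] by rewrite -(setD1K yS) Sy setU0.
  split=> //; first by rewrite sumS Sy big_set0.
  rewrite sumS Sy big_set0 leqn0 => /eqP y0 i; rewrite {1}S1 inE => /eqP ->.
  split=> //; rewrite y0 big1 // => j; rewrite {1}S1 inE => /andP[/eqP ->].
  by rewrite ltnn.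
have ltS : (#|S :\ y| < m)%N by move: leSm; rewrite (cardsD1 y S) yS.
have [w wS [gapw sumw tight]] := IHm _ ltS Sy.
have /andP[wy wS'] : (w != y) && (w \in S) by move: wS; rewrite in_setD1.
have gap_wy := gap w wS' wy.
have sumE : (\sum_(j in S | j != y) a j
    = a w + \sum_(j in S :\ y | j != w) a j)%N.
  by rewrite sumS (bigD1 w) //=.
split=> //; first by rewrite sumE; lia.
rewrite sumE => le_y.
have tightw : (alpha w <= \sum_(j in S :\ y | j != w) a j)%N by lia.
have {tightw}tight := tight tightw.
have below j : j \in S :\ y -> (j < y)%N.
  move=> jS; apply: leq_ltn_trans (proj2 (tight j jS)) _.
  rewrite ltnNge; apply/negP => le_yw.
  have : (y : nat) <> w by move/val_inj/eqP; rewrite eq_sym; apply/negP.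
  by move=> ?; move: gap_wy; case: ltnP => ?; lia.
move=> i iS; have [->|iy] := eqVneq i y.
  split=> //; transitivity (\sum_(j in S | j != y) a j)%N; first by lia.
  apply: eq_bigl => j; apply: andb_id2l => jS.
  apply/idP/idP => [jy|]; first by apply: below; rewrite in_setD1 jy.
  by apply: contraTneq => ->; rewrite ltnn.
have iS' : i \in S :\ y by rewrite in_setD1 iy.
have [-> _] := tight i iS'; split; last exact/ltnW/below.
apply: eq_bigl => j; rewrite in_setD1; have [->|//] := eqVneq j y.
by rewrite ltnNge (ltnW (below i iS')) /= andbF.
Qed.

Definition block_start n (a : 'I_n -> nat) (i : nat) : nat :=
  \sum_(k < n | (0 < k < i)%N) a k.

(** Blocks 1, ..., n side by side, then a gap of one, then block 0. *)
Definition survivor n (a : 'I_n.+1 -> nat) (i : 'I_n.+1) : nat :=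
  if i == ord0 then (\sum_(k < n.+1 | (0 < k)%N) a k).+1 else block_start a i.

Lemma ord_gt0 n (k : 'I_n.+1) : (0 < k)%N = (k != ord0).
Proof. by rewrite lt0n. Qed.

(** If the last block is not block 0, its bound is met only by the tight
arrangement in increasing order, which the last hypothesis excludes.  If it is
block 0, there is one unit of slack, which the descent to index 0 uses up; the
other blocks are then tight. *)
Lemma separated_eq_survivor n (a alpha : 'I_n.+1 -> nat) (r : 'I_n.+1) :
  (0 < r)%N -> separated a alpha ->
  (forall i, alpha i <= \sum_(j | j != i) a j + (i == ord0))%N ->
  alpha r <> (a ord0 + block_start a r)%N ->
  alpha =1 survivor a.
Proof.
move=> r0 sep bound exclude.
have [|y _ [gap _ tight]] := @separated_last _ a alpha setT sep.
  by apply/set0Pn; exists r; rewrite inE.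
have [y0|y0] := eqVneq y ord0; last first.
  have [|E _] := tight _ r (in_setT r).
    rewrite (leq_trans (bound y)) // (negPf y0) addn0.
    by rewrite [leqRHS](eq_bigl (fun j => j != y)) // => j; rewrite inE.
  case: exclude; rewrite E /block_start (bigD1 ord0) ?inE //=.
  by congr (_ + _)%N; apply: eq_bigl => k; rewrite inE ord_gt0 andbC.
have := @separated_last _ a alpha (~: [set ord0]) sep.
case=> [|w]; first by apply/set0Pn; exists r; rewrite !inE -ord_gt0.
rewrite !inE => w0 [_ le_w tight_w].
have gap0 : (alpha w + a w + 1 <= alpha ord0)%N.
  by have := gap w (in_setT w); rewrite y0 w0 ord_gt0 w0; apply.
have bound0 := bound ord0; rewrite eqxx addn1 in bound0.
have sumE : (\sum_(j | j != ord0) a j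
    = a w + \sum_(j in ~: [set ord0] | j != w) a j)%N.
  by rewrite (bigD1 w) //=; congr (_ + _)%N; apply: eq_bigl => j; rewrite !inE.
have le_w0 : (alpha w <= \sum_(j in ~: [set ord0] | j != w) a j)%N by lia.
have {le_w0}tight_w := tight_w le_w0.
move=> i; rewrite /survivor; case: eqP => [->|/eqP i0].
  apply/eqP; rewrite (eq_bigl _ _ (@ord_gt0 n)) eqn_leq bound0 sumE /=.
  by apply: leq_trans gap0; rewrite addn1 ltnS addnC leq_add2r.
have [|-> _] := tight_w i; first by rewrite !inE.
by apply: eq_bigl => k; rewrite !inE ord_gt0.
Qed.

(** * Products along consecutive blocks *)

Lemma block_start1 n (a : 'I_n -> nat) : block_start a 1 = 0%N.
Proof. by rewrite /block_start big_pred0 // => k; case: (val k) => [|[]]. Qed.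

Lemma block_startS n (a : 'I_n -> nat) (i : 'I_n) :
  (0 < i)%N -> block_start a i.+1 = (block_start a i + a i)%N.
Proof.
move=> i0; rewrite /block_start (bigD1 i) /= ?i0 ?ltnSn // addnC.
congr (_ + _)%N; apply: eq_bigl => k; rewrite -val_eqE /= ltnS; lia.
Qed.

Lemma block_start_end n (a : 'I_n -> nat) :
  block_start a n = (\sum_(k < n | (0 < k)%N) a k)%N.
Proof. by rewrite /block_start; apply: eq_bigl => k; rewrite ltn_ord andbT. Qed.

Lemma block_start_mono n (a : 'I_n -> nat) : {homo block_start a : i j / (i <= j)%N}.
Proof.
move=> i j le_ij; rewrite /block_start [leqLHS]big_mkcond [leqRHS]big_mkcond /=.
apply: leq_sum => k _; case: (boolP (0 < k < i)%N) => // /andP[k0 ki].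
by rewrite k0 (leq_trans ki).
Qed.

Lemma big_ord_shift (R : Type) (idx : R) (op : Monoid.law idx) (G : nat -> R) b m :
  \big[op/idx]_(t < m) G (t + b)%N = \big[op/idx]_(b <= k < b + m) G k.
Proof. by rewrite -{2}[b]add0n big_addn addKn big_mkord. Qed.

Lemma big_ord_interval (R : Type) (idx : R) (op : Monoid.com_law idx)
    (H : nat -> R) l m N :
  (m <= N)%N ->
  \big[op/idx]_(j < N | (l <= j < m)%N) H j = \big[op/idx]_(l <= j < m) H j.
Proof.
move=> le_mN; rewrite -(big_mkord (fun j => (l <= j < m)%N)).
rewrite [RHS](big_nat_widen _ _ N) // [RHS](big_nat_widenl _ 0) //.
by apply: eq_bigl => j; rewrite andbC.
Qed.

Lemma big_nat_tile (R : Type) (idx : R) (op : Monoid.law idx) (G : nat -> R)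
    (b : nat -> nat) l m :
  {homo b : i j / (i <= j)%N} -> (l <= m)%N ->
  \big[op/idx]_(l <= j < m) \big[op/idx]_(b j <= k < b j.+1) G k
    = \big[op/idx]_(b l <= k < b m) G k.
Proof.
move=> bmono le_lm.
rewrite (telescope_big (fun i j => \big[op/idx]_(b i <= k < b j) G k)).
  by case: ltnP => // le_ml; rewrite big_geq ?bmono.
by move=> k /andP[lt_lk _]; rewrite -big_cat_nat ?bmono // ltnW.
Qed.

(** * Evaluation at the surviving grid point *)

Section Evaluation.

Variables (F : fieldType) (q : F).
Hypothesis q_inj : injective (GRing.exp q).

Local Notation qp k := (qpoch q q k).

Lemma qpochS k : qp k.+1 = qp k * (1 - q ^+ k.+1).
Proof. by rewrite /qpoch big_ord_recr /= exprS. Qed.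

Lemma subr1_expr_neq0 k : 1 - q ^+ k.+1 != 0.
Proof. by rewrite subr_eq0 -(expr0 q); apply/eqP => /q_inj. Qed.

Lemma qpoch_neq0 k : qp k != 0.
Proof.
elim: k => [|k IHk]; first by rewrite /qpoch big_ord0 oner_eq0.
by rewrite qpochS mulf_neq0 ?subr1_expr_neq0.
Qed.

(** For k = b + l the difference is q^b (1 - q^l), and l runs over
u + 1, ..., u + m. *)
Lemma prod_expr_sub b u m :
  \prod_((b + u).+1 <= k < (b + u + m).+1) (q ^+ b - q ^+ k)
    = q ^+ (b * m) * (qp (u + m) / qp u).
Proof.
elim: m => [|m IHm].
  by rewrite !addn0 big_geq // muln0 divff ?qpoch_neq0 // mulr1.
rewrite addnS big_nat_recr ?ltnS ?leq_addr //= IHm addnS qpochS mulnS exprD.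
have -> : q ^+ (b + u + m).+1 = q ^+ b * q ^+ (u + m).+1.
  by rewrite -exprD; congr (_ ^+ _); lia.
by field; rewrite ?qpoch_neq0.
Qed.

Lemma node_weightE d j : (j <= d)%N ->
  node_weight (GRing.exp q) d j =
  \prod_(0 <= k < j) (q ^+ j - q ^+ k) * \prod_(j.+1 <= k < d.+1) (q ^+ j - q ^+ k).
Proof.
move=> le_jd; rewrite /node_weight.
rewrite -(big_mkord (fun k => k != j) (fun k => q ^+ j - q ^+ k)).
rewrite (big_cat_nat (n := j)) //=; last exact: leqW.
congr (_ * _).
  rewrite big_nat_cond [RHS]big_nat_cond; apply: eq_bigl => k.
  by case: ltngtP; rewrite ?andbF.
rewrite big_ltn_cond ?ltnS // eqxx /= big_nat_cond [RHS]big_nat_cond.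
by apply: eq_bigl => k; case: ltngtP; rewrite ?andbF.
Qed.

(** The blocks before i tile [0, alpha_i) and block 0 tiles [a + 1, sigma + 1).
The blocks after i contribute their translates by one, which tile
[alpha_i + a_i + 1, a + 1). *)
Lemma dyson_factor_pos n (a : 'I_n.+1 -> nat) (i : 'I_n.+1) : (0 < i)%N ->
  \prod_(j < n.+1 | j != i) \prod_(t < a j)
     (q ^+ survivor a i - q ^+ (t + (i < j)) * q ^+ survivor a j)
  = \prod_(0 <= k < block_start a i) (q ^+ block_start a i - q ^+ k)
    * \prod_((block_start a i.+1).+1 <= k < (\sum_j a j).+1)
        (q ^+ block_start a i - q ^+ k).
Proof.
move=> i0.
have i_neq0 : i != ord0 by rewrite -ord_gt0.
rewrite /survivor (negPf i_neq0).
set b := block_start a; pose G k := q ^+ b i - q ^+ k.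
have bS (j : 'I_n.+1) : (0 < j)%N -> b j.+1 = (b j + a j)%N by apply: block_startS.
have le_iSn : (i < n.+1)%N := ltn_ord i.
have sumE : (\sum_j a j = b n.+1 + a ord0)%N.
  rewrite /b block_start_end (bigD1 ord0) //= addnC; congr (_ + _)%N.
  by apply: eq_bigl => k; rewrite -val_eqE lt0n.
rewrite (bigID (fun j : 'I_n.+1 => (j < i)%N)) /= (bigD1 ord0) /=; last first.
  by rewrite eq_sym i_neq0.
rewrite [X in _ * X](_ : _ = \prod_((b i.+1).+1 <= k < (b n.+1).+1) G k); last first.
  rewrite -(big_nat_tile _ _ (b := fun j => (b j).+1)) //; last first.
    by move=> j k /(block_start_mono a); rewrite ltnS.
  rewrite -(big_ord_interval _ _ _ (leqnn _)); apply: eq_big => [j|j].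
    by rewrite -leqNgt ltn_ord andbT ltn_neqAle -val_eqE eq_sym.
  rewrite -leqNgt => /andP[ji le_ij].
  have ij : (i < j)%N by rewrite ltn_neqAle eq_sym val_eqE ji.
  have j0 : (0 < j)%N := leq_ltn_trans (leq0n i) ij.
  rewrite (negPf (_ : j != ord0)) -?ord_gt0 // ij bS // -addSn -big_ord_shift.
  by apply: eq_bigr => t _; rewrite -exprD /G; congr (_ - _ ^+ _); lia.
rewrite [X in X * _ * _](_ : _ =
   \prod_((b n.+1).+1 <= k < (\sum_j a j).+1) G k); last first.
  rewrite sumE -addSn -big_ord_shift; apply: eq_bigr => t _.
  rewrite -exprD /G /b block_start_end; congr (_ - _ ^+ _).
  by rewrite addn0.
rewrite [X in _ * X * _](_ : _ = \prod_(b 1%N <= k < b i) G k); last first.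
  rewrite -(big_nat_tile _ _ (b := b)) //; last exact: block_start_mono.
  rewrite -(big_ord_interval _ _ _ (ltnW le_iSn)); apply: eq_big => [j|j].
    by rewrite -!val_eqE lt0n /=; lia.
  move=> /andP[/andP[_ ji] j_neq0]; rewrite (negPf j_neq0).
  have j0 : (0 < j)%N by rewrite ord_gt0.
  rewrite bS // -big_ord_shift.
  apply: eq_bigr => t _; rewrite -exprD /G; congr (_ - _ ^+ _).
  by rewrite ltnNge ltnW // addn0.
rewrite [b 1%N]block_start1 mulrAC mulrC; congr (_ * _).
rewrite mulrC -big_cat_nat //= ltnS; first exact: block_start_mono.
by rewrite sumE leq_addr.
Qed.

(** The translates by one of the blocks 1, ..., n tile [1, a + 1). *)
Lemma dyson_factor0 n (a : 'I_n.+1 -> nat) :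
  \prod_(j < n.+1 | j != ord0) \prod_(t < a j)
     (q ^+ survivor a ord0 - q ^+ (t + (@ord0 n < j)) * q ^+ survivor a j)
  = \prod_(1 <= k < survivor a ord0) (q ^+ survivor a ord0 - q ^+ k).
Proof.
set G := q ^+ survivor a ord0.
have -> : survivor a ord0 = (block_start a n.+1).+1.
  by rewrite /survivor eqxx block_start_end.
have start1 : 1%N = (block_start a 1).+1 by rewrite block_start1.
rewrite [X in \prod_(X <= _ < _) _]start1.
rewrite -(big_nat_tile _ _ (b := fun j => (block_start a j).+1)) //; last first.
  by move=> j k /(block_start_mono a); rewrite ltnS.
rewrite -(big_ord_interval _ _ _ (leqnn _)); apply: eq_big => [j|j j_neq0].
  by rewrite ltn_ord andbT ord_gt0.
have j0 : (0 < j)%N by rewrite ord_gt0.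
rewrite j0 /survivor (negPf j_neq0) block_startS // -addSn -big_ord_shift.
by apply: eq_bigr => t _; rewrite -exprD; congr (_ - _ ^+ _); lia.
Qed.

(** Numerator and denominator agree below alpha_i; above it they have the same
number of factors, hence the same power of q. *)
Lemma dyson_ratio_pos n (a : 'I_n.+1 -> nat) (i : 'I_n.+1) : (0 < i)%N ->
  (\prod_(j < n.+1 | j != i) \prod_(t < a j)
     (q ^+ survivor a i - q ^+ (t + (i < j)) * q ^+ survivor a j))
    / node_weight (GRing.exp q) (\sum_(j < n.+1 | j != i) a j) (survivor a i)
  = qp (\sum_j a j - block_start a i) / qp (\sum_j a j - block_start a i.+1)
      / qp (a i).
Proof.
move=> i0; rewrite dyson_factor_pos //.
have -> : survivor a i = block_start a i.
  by rewrite /survivor (negPf (_ : i != ord0)) -?ord_gt0.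
have sumE : (\sum_j a j = a i + \sum_(j < n.+1 | j != i) a j)%N by rewrite (bigD1 i).
have le_b : (block_start a i.+1 <= \sum_j a j)%N.
  by rewrite /block_start big_mkcond; apply: leq_sum => k _; case: ifP.
rewrite block_startS // in le_b *.
set b := block_start a i in le_b *; set m := (\sum_j a j - (b + a i))%N.
have sum' : (\sum_(j < n.+1 | j != i) a j = b + m)%N by rewrite /m sumE; lia.
rewrite sum' node_weightE; last by rewrite leq_addr.
have -> : (\sum_j a j = b + a i + m)%N by rewrite /m subnKC.
have := prod_expr_sub b 0 m; rewrite addn0 add0n => ->.
rewrite prod_expr_sub -addnA addKn.
have -> : qp 0 = 1 by rewrite /qpoch big_ord0.
have q0 : q != 0.
  by apply/eqP => q0; have /q_inj : q ^+ 1 = q ^+ 2 by rewrite q0 !expr0n.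
have P0 : \prod_(0 <= k < b) (q ^+ b - q ^+ k) != 0.
  rewrite big_nat_cond prodf_seq_neq0; apply/allP => k _.
  apply/implyP => /andP[/andP[_ kb] _]; rewrite subr_eq0; apply: contraTneq kb.
  by move=> /q_inj ->; rewrite ltnn.
by field; rewrite P0 !qpoch_neq0 oner_eq0 expf_neq0.
Qed.

(** Only the node q^0 of the weight is not matched by a factor. *)
Lemma dyson_ratio0 n (a : 'I_n.+1 -> nat) :
  (\prod_(j < n.+1 | j != ord0) \prod_(t < a j)
     (q ^+ survivor a ord0 - q ^+ (t + (@ord0 n < j)) * q ^+ survivor a j))
    / node_weight (GRing.exp q) (\sum_(j < n.+1 | j != ord0) a j).+1 (survivor a ord0)
  = - (1 - q ^+ survivor a ord0)^-1.
Proof.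
rewrite dyson_factor0.
have -> : (\sum_(j < n.+1 | j != ord0) a j).+1 = survivor a ord0.
  rewrite /survivor eqxx; congr S; apply: eq_bigl => k.
  by rewrite ord_gt0.
rewrite node_weightE // [X in _ / (_ * X)]big_geq // mulr1.
rewrite [X in _ / X]big_ltn; last by rewrite /survivor eqxx.
have P0 : \prod_(1 <= k < survivor a ord0) (q ^+ survivor a ord0 - q ^+ k) != 0.
  rewrite big_nat_cond prodf_seq_neq0; apply/allP => k _.
  apply/implyP => /andP[/andP[_ kb] _]; rewrite subr_eq0; apply: contraTneq kb.
  by move=> /q_inj ->; rewrite ltnn.
by rewrite invfM mulrCA divff // mulr1 expr0 -opprB invrN.
Qed.

(** The identity holds for any q whose powers are pairwise distinct, which is what
the grid requires. *)
Theorem is_CT_first_layer_qDyson n (a : 'I_n.+1 -> nat) (r : 'I_n.+1) :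
  (0 < r)%N ->
  is_CT (rf_var F r / rf_var F ord0 * qDyson q a)
    (- q ^+ block_start a r
     * ((1 - q ^+ a ord0) / (1 - q ^+ (\sum_(k < n.+1 | (0 < k)%N) a k).+1))
     * (qp (\sum_k a k) / \prod_(k < n.+1) qp (a k))).
Proof.
move=> r0.
pose d := (dyson_expo a + U_(ord0))%MM.
have dE i : d i = (\sum_(j | j != i) a j + (i == ord0))%N.
  by rewrite mnmDE mnmE mnm1E eq_sym.
have dm : mdeg d = (mdeg (dyson_expo a)).+1 by rewrite mdegD mdeg1 addn1.
have [coefE sizeP] := mcoeff_shift_top r (q ^+ (a ord0 + block_start a r))
  (dyson_homog q a) dm.
have := is_CT_ratio_qDyson q a r ord0; rewrite -coefE.
suff -> : (('X_r - (q ^+ (a ord0 + block_start a r))%:MP) * dyson_poly q a)@_d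
  = - q ^+ block_start a r
     * ((1 - q ^+ a ord0) / (1 - q ^+ (\sum_(k < n.+1 | (0 < k)%N) a k).+1))
     * (qp (\sum_k a k) / \prod_(k < n.+1) qp (a k)) by [].
have evalE (g : 'I_n.+1 -> nat) :
    (('X_r - (q ^+ (a ord0 + block_start a r))%:MP)
       * dyson_poly q a).@[fun i => q ^+ g i]
  = (q ^+ g r - q ^+ (a ord0 + block_start a r))
    * \prod_(i < n.+1) \prod_(j < n.+1 | j != i) \prod_(t < a j)
        (q ^+ g i - q ^+ (t + (i < j)) * q ^+ g j).
  rewrite mevalM mevalB mevalXU mevalC rmorph_prod; congr (_ * _).
  apply: eq_bigr => i _; rewrite rmorph_prod; apply: eq_bigr => j _.
  rewrite rmorph_prod; apply: eq_bigr => t _.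
  by rewrite /= mevalB mevalZ !mevalXU.
rewrite (@mcoeff_grid1 _ _ (GRing.exp q) d _ (survivor a)) //; first last.
- move=> f fd; rewrite evalE mulf_eq0 negb_or => /andP[fr fD].
  apply: (separated_eq_survivor r0) => [i j t ij ta fij|i|fE].
  + have /prodf_neq0/(_ i isT)/prodf_neq0/(_ j) := fD.
    rewrite eq_sym ij => /(_ isT)/prodf_neq0/(_ (Ordinal ta) isT) /=.
    by rewrite -exprD fij subr_eq0 -addnA addnC eqxx.
  + by rewrite -dE.
  + by rewrite fE subrr eqxx in fr.
- move=> i; rewrite dE /survivor; case: eqP => [->|/eqP i0].
    by rewrite addn1 ltnS (eq_bigl _ _ (@ord_gt0 n)).
  rewrite addn0 /block_start big_mkcond [leqRHS]big_mkcond /=.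
  apply: leq_sum => k _; case: ifP => // /andP[_ ki].
  by rewrite -val_eqE (ltn_eqF ki).
rewrite evalE -[LHS]mulrA -prodf_div (bigD1 ord0) //=.
rewrite dE eqxx addn1 dyson_ratio0.
under eq_bigr => i i0.
  rewrite dE (negPf i0) addn0 dyson_ratio_pos ?ord_gt0 //.
  over.
rewrite /= prodf_div -(eq_bigl _ _ (@ord_gt0 n)) /=.
have tele : \prod_(i < n.+1 | (0 < i)%N)
    (qp (\sum_j a j - block_start a i) / qp (\sum_j a j - block_start a i.+1))
    = qp (\sum_j a j) / qp (a ord0).
  rewrite (eq_bigl (fun i : 'I_n.+1 => (1 <= i < n.+1)%N)); last first.
    by move=> i; rewrite ltn_ord andbT.
  rewrite (big_ord_interval _ (fun i => qp (\sum_j a j - block_start a i)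
    / qp (\sum_j a j - block_start a i.+1))) //.
  rewrite (@telescope_prodr _ _ _ (fun i => qp (\sum_j a j - block_start a i))).
  - rewrite block_start1 subn0 block_start_end (bigD1 ord0) //=.
    by rewrite -(eq_bigl _ _ (@ord_gt0 n)) addnK.
  - by move=> k _; rewrite unitfE qpoch_neq0.
  - exact: leq_ltn_trans r0 (ltn_ord r).
rewrite tele.
rewrite (_ : survivor a r = block_start a r); last first.
  by rewrite /survivor (negPf (_ : r != ord0)) -?ord_gt0.
rewrite [survivor a ord0]/survivor eqxx.
rewrite [X in _ = _ * (_ / X)](bigD1 ord0) //=.
rewrite exprD.
have P0 : \prod_(k < n.+1 | k != ord0) qp (a k) != 0.
  by apply/prodf_neq0 => k _; apply: qpoch_neq0.
by field; rewrite P0 !qpoch_neq0 subr1_expr_neq0.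
Qed.

End Evaluation.

Lemma expr_qvar_inj (K : fieldType) : injective (GRing.exp (qvar K)).
Proof.
move=> i j /eqP; rewrite -!rmorphXn tofrac_eq => /eqP /(congr1 (size \o val)) /=.
by rewrite !size_polyXn => -[].
Qed.

Theorem corollary1p4 (K : fieldType) (n : nat) (hn : (1 <= n)%N)
    (a : 'I_n.+1 -> nat) (r : 'I_n.+1) (hr : (0 < r)%N) :
  let q := qvar K in
  let x := @rf_var {fraction {poly K}} n.+1 in
  let asum := (\sum_(k < n.+1 | (0 < k)%N) a k)%N in
  is_CT (x r / x ord0 * qDyson q a)
    (- q ^+ (\sum_(k < n.+1 | (1 <= k < r)%N) a k)
     * ((1 - q ^+ a ord0) / (1 - q ^+ (asum + 1)))
     * (qpoch q q (asum + a ord0) / \prod_(k < n.+1) qpoch q q (a k))).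
Proof.
move=> q x asum; have := is_CT_first_layer_qDyson (@expr_qvar_inj K) a hr.
rewrite [(\sum_k a k)%N](_ : _ = (asum + a ord0)%N) ?addn1 //.
rewrite (bigD1 ord0) //= addnC /asum; congr (_ + _)%N.
by apply: eq_bigl => k; rewrite ord_gt0.
Qed.
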